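(* For every positive integer $a$, $R_2(x+ay=2az)=a^2$.
   Context: For a positive integer $N$ let $[N]=\{1,\dots,N\}$. For a linear homogeneous equation $\mathcal{E}$ with integer coefficients and a positive integer $c$, the Rado number $R_c(\mathcal{E})$ is the least positive integer $N$ such that every $c$-coloring of $[N]$ contains a monochromatic solution to $\mathcal{E}$, i.e. a solution whose variables all take values in $[N]$ (not necessarily distinct) having the same color. If no such $N$ exists, $R_c(\mathcal{E})=\infty$. *)

(* Defs.v *)
From Stdlib Require Import ClassicalEpsilon.
From mathcomp Require Import all_boot all_order all_algebra.

Set Implicit Arguments.
Unset Strict Implicit.
Unset Printing Implicit Defensive.

Import GRing.Theory Num.Theory.
Local Open Scope ring_scope.

(* A linear homogeneous equation  e_0 x_0 + ... + e_(k-1) x_(k-1) = 0  with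
   integer coefficients is the tuple of its coefficients. *)
Definition lin_eq (k : nat) := k.-tuple int.

Definition solution (k : nat) (e : lin_eq k) (x : 'I_k -> nat) : bool :=
  \sum_(i < k) tnth e i * (x i)%:Z == 0.

(* [N] = {1, ..., N} is represented by 'I_N, whose element j stands for the
   integer j + 1. *)
Definition coloring (c N : nat) := {ffun 'I_N -> 'I_c}.

Definition mono_solution (k c N : nat) (e : lin_eq k) (chi : coloring c N)
    (x : {ffun 'I_k -> 'I_N}) : bool :=
  solution e (fun i => (x i).+1)
  && [exists col : 'I_c, [forall i : 'I_k, chi (x i) == col]].

Definition every_coloring_has_mono_solution (k c : nat) (e : lin_eq k)
    (N : nat) : bool :=
  [forall chi : coloring c N,
     [exists x : {ffun 'I_k -> 'I_N}, mono_solution e chi x]].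

Definition rado_bound (k c : nat) (e : lin_eq k) (N : nat) : bool :=
  (0 < N)%N && every_coloring_has_mono_solution c e N.

(* None stands for infinity. *)
Definition rado_number (k c : nat) (e : lin_eq k) : option nat :=
  match excluded_middle_informative (exists N, rado_bound c e N) with
  | left exN => Some (ex_minn exN)
  | right _ => None
  end.

(* Main.v *)
Require Import Defs.
From mathcomp Require Import all_boot all_order all_algebra.
From mathcomp Require Import zify.

Import GRing.Theory Num.Theory.
Local Open Scope ring_scope.

(** In a solution x is a multiple of a, say x = a w, and the equation becomes
    w + y = 2 z.  Below a ^ 2, colour n by whether a divides n: if a divides
    y and z then it divides w, so x >= a ^ 2.

    Conversely suppose a colouring c of [a ^ 2] has no monochromatic solution.
    The solutions (a w, w, w) give c (a w) <> c w for w <= a; hence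
    c 1 <> c a <> c (a ^ 2), and reflecting w <= a in a point z of the other
    colour yields the colour of w again.  These reflections force c to
    alternate on all of [a ^ 2]; then c 1 <> c a makes a even, and
    c a <> c (a ^ 2) is contradicted. *)

Section Reflection.

Variables (a : nat) (c : nat -> bool).
Hypothesis a_gt1 : (1 < a)%N.
Hypothesis reflect_color : forall w y z : nat, (0 < w <= a)%N ->
  (0 < y <= a ^ 2)%N -> (0 < z <= a ^ 2)%N -> (w + y = z.*2)%N ->
  c z = ~~ c w -> c y = c w.
Hypothesis c1a : c a = ~~ c 1%N.

(** Reflecting points up to a in their neighbours reaches a + 2, which must stay inside [a ^ 2]. *)
Let a_add2_le : (a + 2 <= a ^ 2)%N.
Proof. by nia. Qed.

Lemma alternate_next (j : nat) :
  (0 < j <= a)%N -> c j.+1 = ~~ c j -> c j.+2 = c j.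
Proof. by move=> ja cj; apply: (reflect_color j _ j.+1) => //; lia. Qed.

(** Otherwise the colours from j on would read A, A, B and then, by [alternate_next] twice, A, B;
    but reflecting j in j + 2 gives colour A at j + 4. *)
Lemma equal_next (j : nat) :
  (0 < j)%N -> (j.+2 <= a)%N -> c j.+1 = c j -> c j.+2 = c j.
Proof.
move=> j0 ja cj; apply/eqP/negPn/negP => /negPf cj2.
have {}cj2 : c j.+2 = ~~ c j by move: cj2; case: (c j.+2) (c j) => -[].
have cj3 : c j.+3 = c j.+1 by apply: alternate_next; [lia | rewrite cj2 cj].
have cj4 : c j.+4 = c j.+2.
  by apply: alternate_next; [lia | rewrite cj3 cj cj2 negbK].
have : c j.+4 = c j by apply: (reflect_color j _ j.+2) => //; lia.
by rewrite cj4 cj2; case: (c j).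
Qed.

(** If 1 and 2 agreed, [equal_next] would spread their colour up to a, against [c1a]. *)
Lemma color2 : c 2 = ~~ c 1%N.
Proof.
apply/eqP/negPn/negP => c12.
have {}c12 : c 2 = c 1%N by move: c12; case: (c 2) (c 1%N) => -[].
have const j : (j.+2 <= a)%N -> c j.+1 = c 1%N /\ c j.+2 = c 1%N.
  elim: j => [//|j IHj] ja.
  have [cj1 cj2] := IHj (ltnW ja).
  by split=> //; rewrite (equal_next j.+1) // cj1 cj2.
have [|_] := const (a - 2)%N; first by lia.
have -> : (a - 2).+2 = a by lia.
by rewrite c1a; case: (c 1%N).
Qed.

(** [alternate_next] carries the alternation upwards from 1 and 2; its condition j <= a is what ends
    the range at a + 2. *)
Lemma alternate_low (n : nat) :
  (0 < n <= a + 2)%N -> c n = ~~ odd n (+) c 1%N.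
Proof.
have alt j : (j <= a)%N ->
    c j.+1 = ~~ odd j.+1 (+) c 1%N /\ c j.+2 = ~~ odd j.+2 (+) c 1%N.
  elim: j => [|j IHj] ja; first by rewrite color2.
  have [cj1 cj2] := IHj (ltnW ja).
  split=> //; rewrite alternate_next ?cj1 ?cj2 //=.
    by rewrite !negbK.
  by case: (odd j) (c 1%N) => -[].
case: n => [|[|n]] // na.
by have [|_ ->] := alt n; first by lia.
Qed.

Lemma alternate_even : ~~ odd a.
Proof.
have := alternate_low a; rewrite c1a leq_addr (ltnW a_gt1) => /(_ isT).
by case: (odd a) (c 1%N) => -[].
Qed.

(** Strong induction: beyond a + 2, n is the reflection of some w <= 4 in a point z < n whose colour
    is already known. *)
Lemma alternate_all (n : nat) :
  (0 < n <= a ^ 2)%N -> c n = ~~ odd n (+) c 1%N.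
Proof.
have a_even := alternate_even.
elim/ltn_ind: n => n IHn /andP[n0 na].
have [nl|nl] := leqP n (a + 2)%N; first by apply: alternate_low; rewrite n0.
(* Ensures w <= a for the w chosen below. For a = 2, a + 2 already equals a ^ 2; a = 3 is odd. *)
have a4 : (4 <= a)%N.
  case: (ltngtP a 2) => [|a_gt2|a2]; [lia | lia |].
  by move: na nl; rewrite a2; lia.
(* w = n - 2 modulo 4, so that w and (n + w) / 2 have opposite parities. *)
pose w := (((n + 1) %% 4).+1)%N; pose z := ((n + w) %/ 2)%N.
have wz : (w + n = z.*2)%N by rewrite /z /w; lia.
have ow : odd w = odd n by rewrite /w; lia.
have oz : odd z = ~~ odd n by rewrite /z /w; lia.
have w4 : (0 < w <= 4)%N by rewrite /w; lia.
have cw : c w = ~~ odd n (+) c 1%N by rewrite alternate_low ?ow //; lia.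
rewrite -cw; apply: (reflect_color w _ z) => //; try lia.
by rewrite cw IHn ?oz ?addNb //; lia.
Qed.

Lemma color_square : c (a ^ 2)%N = c a.
Proof.
have a_in : (0 < a <= a ^ 2)%N by lia.
have a2_in : (0 < a ^ 2 <= a ^ 2)%N by lia.
by rewrite (alternate_all _ a_in) (alternate_all _ a2_in) oddX.
Qed.

End Reflection.

Lemma exists_mono_triple (a : nat) (c : nat -> bool) : (0 < a)%N ->
  exists w y z : nat, [/\ (0 < w <= a)%N, (0 < y <= a ^ 2)%N,
    (0 < z <= a ^ 2)%N, (w + y = z.*2)%N & c (a * w)%N = c y /\ c y = c z].
Proof.
move=> a_gt0; have [a_gt1|a_le1] := ltnP 1 a; last first.
  by exists 1%N, 1%N, 1%N; have -> : a = 1%N by lia.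
apply: Classical_Prop.NNPP => no_mono.
have avoid w y z : (0 < w <= a)%N -> (0 < y <= a ^ 2)%N ->
    (0 < z <= a ^ 2)%N -> (w + y = z.*2)%N -> c (a * w)%N = c y ->
    c z = ~~ c y.
  move=> wa ya za wyz cwy; apply/eqP/negPn/negP => czy.
  apply: no_mono; exists w, y, z; split=> //; split=> //.
  by move: czy; case: (c y) (c z) => -[].
have a_le2 : (a <= a ^ 2)%N by nia.
have cmul w : (0 < w <= a)%N -> c (a * w)%N = ~~ c w.
  move=> wa; apply/eqP/negPn/negP => cw.
  have : c w = ~~ c w.
    by apply: (avoid w); rewrite ?addnn //; lia.
  by case: (c w).
(* If y had the other colour than w, it would share that of a w; then z, avoiding it, would have the
   colour of w. *)
have reflect_color w y z : (0 < w <= a)%N -> (0 < y <= a ^ 2)%N ->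
    (0 < z <= a ^ 2)%N -> (w + y = z.*2)%N -> c z = ~~ c w -> c y = c w.
  move=> wa ya za wyz czw; apply/eqP/negPn/negP => cyw.
  have cwy : c (a * w)%N = c y.
    by rewrite cmul //; move: cyw; case: (c y) (c w) => -[].
  have := avoid w y z wa ya za wyz cwy.
  by rewrite czw; move: cyw; case: (c y) (c w) => -[].
have c1a : c a = ~~ c 1%N by rewrite -[in LHS](muln1 a) cmul.
have := color_square a c a_gt1 reflect_color c1a.
by rewrite -mulnn cmul ?a_gt0 ?leqnn //; case: (c a).
Qed.

Lemma solutionE (a : nat) (x : 'I_3 -> nat) :
  solution [tuple 1; a%:Z; - (2 * a%:Z)] x
    = (x ord0 + a * x (inord 1) == 2 * a * x (inord 2))%N.
Proof.
rewrite /solution !big_ord_recl big_ord0 !(tnth_nth 0) /=.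
have -> : lift ord0 ord0 = inord 1 :> 'I_3 by apply: val_inj; rewrite /= inordK.
have -> : lift ord0 (lift ord0 ord0) = inord 2 :> 'I_3.
  by apply: val_inj; rewrite /= inordK.
by lia.
Qed.

Lemma mono_solutionP (k c N : nat) (e : lin_eq k) (chi : coloring c N)
    (x : {ffun 'I_k -> 'I_N}) (i0 : 'I_k) :
  reflect (solution e (fun i => (x i).+1) /\ forall i, chi (x i) = chi (x i0))
          (mono_solution e chi x).
Proof.
apply: (iffP andP) => [[sol /existsP[col /forallP mono]]|[sol mono]]; split=> //.
  by move=> i; rewrite (eqP (mono i)) (eqP (mono i0)).
by apply/existsP; exists (chi (x i0)); apply/forallP => i; apply/eqP.
Qed.

Lemma rado_bound_square (a : nat) : (0 < a)%N ->
  rado_bound 2 [tuple 1; a%:Z; - (2 * a%:Z)] (a ^ 2).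
Proof.
move=> a_gt0; rewrite /rado_bound expn_gt0 a_gt0 /=.
apply/forallP; have := @exists_mono_triple a _ a_gt0.
have : (0 < a ^ 2)%N by rewrite expn_gt0 a_gt0.
have : (a * a = a ^ 2)%N by rewrite mulnn.
case: (a ^ 2)%N => // m am _ mono chi.
(* The integer n is the element n - 1 of the ordinal type; with two colours, being [ord0] or not
   determines the colour. *)
have [w [y [z [wa ya za wyz]]]] := mono (fun n => chi (inord n.-1) == ord0).
have eq2 (i j : 'I_2) : (i == ord0) = (j == ord0) -> i = j.
  by case: i j => -[|[|]] // ? [[|[|]]] // ? _; apply: val_inj.
case=> /eq2 cwy /eq2 cyz.
pose v (i : 'I_3) := nth 0%N [:: a * w; y; z]%N i.
have v1 : v (inord 1) = y by rewrite /v inordK.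
have v2 : v (inord 2) = z by rewrite /v inordK.
have v_bound i : (0 < v i <= m.+1)%N.
  case: i => -[|[|[|]]] //= i; rewrite /v //=; nia.
pose x := [ffun i : 'I_3 => inord (v i).-1 : 'I_m.+1].
have xE i : (x i).+1 = v i.
  by rewrite ffunE inordK; have := v_bound i; lia.
apply/existsP; exists x; apply/(mono_solutionP _ _ _ _ _ _ ord0); split.
  by rewrite solutionE !xE v1 v2 /v /=; nia.
move=> i; rewrite !ffunE; by case: i => -[|[|[|]]] //= i; rewrite /v /= cwy.
Qed.

Lemma rado_bound_ge_square (a N : nat) :
  rado_bound 2 [tuple 1; a%:Z; - (2 * a%:Z)] N -> (a ^ 2 <= N)%N.
Proof.
case/andP=> _ /forallP bound; rewrite leqNgt; apply/negP => Na.
pose chi : coloring 2 N := [ffun j : 'I_N => inord (a %| j.+1)%N].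
have [x /(mono_solutionP _ _ _ _ _ _ ord0)[]] := existsP (bound chi).
rewrite solutionE => /eqP sol mono.
have dvd_eq i : (a %| (x i).+1)%N = (a %| (x ord0).+1)%N.
  have /(congr1 val) := mono i; rewrite !ffunE /= !inordK //; try by case: dvdn.
  by case: dvdn; case: dvdn.
(* The equation itself makes x a multiple of a, so the common colour is that of the multiples of
   a. *)
have dvd_x0 : (a %| (x ord0).+1)%N.
  rewrite -(dvdn_addl (x ord0).+1 (dvdn_mulr (x (inord 1)).+1 (dvdnn a))) sol.
  by rewrite -mulnA mulnCA dvdn_mulr.
have := dvd_eq (inord 1); have := dvd_eq (inord 2); rewrite dvd_x0.
have := ltn_ord (x ord0).
case/dvdnP: dvd_x0 sol => w x0E; rewrite x0E.
have w_gt0 : (0 < w)%N by case: w x0E.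
move: (x (inord 1)).+1 (x (inord 2)).+1 => y z sol xN az ay.
have a_gt0 : (0 < a)%N by lia.
have wyz : (w + y = 2 * z)%N.
  by apply/eqP; rewrite -(eqn_pmul2l a_gt0); lia.
have /dvdnP[q wq] : (a %| w)%N by rewrite -(dvdn_addl w ay) wyz dvdn_mull.
by move: xN w_gt0; rewrite wq muln_gt0 => xN /andP[q_gt0 _]; nia.
Qed.

Theorem theorem3p6 (a : nat) (ha : (0 < a)%N) :
  rado_number 2 [tuple 1; a%:Z; - (2 * a%:Z)] = Some (a ^ 2)%N.
Proof.
rewrite /rado_number; case: ClassicalEpsilon.excluded_middle_informative.
  move=> exN; congr Some; case: ex_minnP => N bound minN.
  apply/eqP; rewrite eqn_leq rado_bound_ge_square // andbT.
  exact/minN/rado_bound_square.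
by case; exists (a ^ 2)%N; apply: rado_bound_square.
Qed.
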